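(* Let $A=\{a_1<a_2<\dots<a_n<\dots\}$ be an infinite subset of $\mathbb{N}=\{1,2,\dots\}$, let $g_n=a_{n+1}-a_n$, and let $\beta\ge1$ be a real number. If there exists a real sequence $(f_n)_{n=1}^\infty$ tending to zero such that, for each $n\ge1$, $$\frac{g_n}{a_{n+1}}\le\frac{\beta}{n}(1+f_n),$$ then $$\underline{\varepsilon}(A)\ge\frac1\beta.$$
   Context: For an infinite set $A\subseteq\mathbb{N}$ and real $x$, let $A(x)=|A\cap[1,x]|$. The lower exponential density of $A$ is $\underline{\varepsilon}(A)=\liminf_{k\to\infty}\frac{\log A(k)}{\log k}$. If $A=\{a_1<a_2<\dots\}$, then equivalently $\underline{\varepsilon}(A)=\liminf_{n\to\infty}\frac{\log n}{\log a_n}$. *)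

(* Defs.v *)
From HB Require Import structures.
From mathcomp Require Import all_boot all_order all_algebra finmap.
From mathcomp Require Import all_classical all_reals all_analysis.

Set Implicit Arguments.
Unset Strict Implicit.
Unset Printing Implicit Defensive.

Import Order.TTheory GRing.Theory Num.Theory.
Import numFieldNormedType.Exports.

Local Open Scope classical_set_scope.
Local Open Scope ring_scope.

(* Sequences indexed from 1 are functions on nat whose value at 0 is
   irrelevant. *)

Definition increasing_enumeration (A : set nat) (a : nat -> nat) : Prop :=
  (forall m n : nat, (0 < m)%N -> (m < n)%N -> (a m < a n)%N) /\
  a @` [set n | (0 < n)%N] = A.

(* fset_set returns the empty set on infinite sets; the set below is always
   finite, since a real number dominates finitely many naturals. *)
Definition counting_fun (R : realType) (A : set nat) (x : R) : nat :=
  #|` fset_set (A `&` [set m | m%:R \in `[1, x]]) |.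

(* The terms with k <= 1 or counting_fun A k%:R = 0, where ln 0 = 0 and _ / 0 = 0
   are conventions, are finitely many when A contains a positive integer. *)
Definition lower_exp_density (R : realType) (A : set nat) : \bar R :=
  limn_einf (fun k : nat => (ln (counting_fun A (k%:R : R))%:R / ln k%:R)%:E).

(* The difference is taken in R, because subtraction on nat truncates. *)
Definition gap (R : realType) (a : nat -> nat) (n : nat) : R :=
  (a n.+1)%:R - (a n)%:R.

(* Main.v *)
Require Import Defs.
From HB Require Import structures.
From mathcomp Require Import all_boot all_order all_algebra finmap.
From mathcomp Require Import all_classical all_reals all_analysis.
From mathcomp Require Import ring lra.

(** The hypothesis bounds the multiplicative growth of [a]. Solving
    [g_n / a_(n+1) <= (beta / n) (1 + f_n)] for [a_(n+1)] gives, for any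
    [c > beta] and all large [n], [a_(n+1) <= (1 + c / (n + 1)) a_n]
    (this rests on [near_ratio_bound]): the slack [c - beta] absorbs both [f_n]
    and the second-order terms. Since [ln (1 + x) <= x] and the steps
    [1 / (n + 1)] of the harmonic series are dominated by
    [ln (n + 1) - ln n], the logarithms telescope to
    [ln a_n <= c ln n + C] ([ln_le_of_ratio_le]).

    It remains to read this off the counting function. If [n = A(k)], then
    [k < a_(n+1)], so [ln k <= c ln (n + 1) + C <= c ln n + c + C]; as [n] tends
    to infinity with [k], the constant is absorbed on passing from [c] to any
    [b > c], and [ln A(k) / ln k >= 1 / b] eventually
    ([lower_exp_density_ge]). Letting [b] decrease to [beta] concludes. *)

Import Order.TTheory GRing.Theory Num.Theory.
Import numFieldNormedType.Exports.

Local Open Scope classical_set_scope.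
Local Open Scope ring_scope.

Lemma invS_le_lnS_sub_ln (R : realType) (n : nat) :
  (0 < n)%N -> (n.+1%:R : R)^-1 <= ln n.+1%:R - ln n%:R.
Proof.
move=> n0; have n0R : (0 : R) < n%:R by rewrite ltr0n.
rewrite -lerN2 opprB -ln_div ?posrE ?ltr0n//.
have -> : n%:R / n.+1%:R = 1 + - (n.+1%:R : R)^-1.
  by rewrite -natr1; field; rewrite natr1 pnatr_eq0.
by apply: le_ln1Dx; rewrite ltrN2 invf_lt1 ?ltr0n// ltr1n ltnS.
Qed.

(** A discrete Gronwall argument: [n] to the power [c] is a supersolution, up to
    a constant factor, of the recurrence [u_(n+1) = (1 + c / (n + 1)) u_n]. *)
Lemma ln_le_of_ratio_le (R : realType) (u : nat -> R) (c : R) :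
  0 <= c ->
  (\forall n \near \oo, 0 < u n) ->
  (\forall n \near \oo, u n.+1 <= (1 + c / n.+1%:R) * u n) ->
  exists C, \forall n \near \oo, ln (u n) <= c * ln n%:R + C.
Proof.
move=> c0 [N1 _ u0] [N2 _ uS].
pose N := maxn (maxn N1 N2) 1.
have [N1N N2N N0] : [/\ (N1 <= N)%N, (N2 <= N)%N & (0 < N)%N].
  by rewrite !leq_max !leqnn !orbT.
exists (ln (u N) - c * ln N%:R); exists N => // n /= Nn.
rewrite -(subnKC Nn); elim: (n - N)%N => [|k IH]; first by rewrite addn0; lra.
rewrite addnS; set m := (N + k)%N in IH *.
have Nm : (N <= m)%N by rewrite leq_addr.
have um0 : 0 < u m by apply: u0; rewrite /= (leq_trans N1N).
have um10 : 0 < u m.+1 by apply: u0; rewrite /= (leq_trans N1N)// leqW.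
have ln_step := ler_wpM2l c0 (invS_le_lnS_sub_ln R _ (leq_trans N0 Nm)).
have : u m.+1 <= (1 + c / m.+1%:R) * u m.
  by apply: uS; rewrite /= (leq_trans N2N).
move: ln_step; have : 0 <= c / m.+1%:R by rewrite divr_ge0.
move: (c / m.+1%:R) => q q0 ln_step uSm.
have q1_gt0 : 0 < 1 + q by lra.
have : ln (u m.+1) <= ln (1 + q) + ln (u m).
  by rewrite -lnM ?posrE// ler_ln ?posrE ?mulr_gt0.
have : ln (1 + q) <= q by apply: le_ln1Dx; lra.
by move: ln_step; rewrite mulrBr; lra.
Qed.

(** The inverse of [1 - b / n] is [1 + b / n + O(1 / n ^ 2)], so any [c > b]
    eventually dominates; stated as a product because the sign of the first
    factor is then immaterial. *)
Lemma near_ratio_bound (R : realType) (f : nat -> R) (b c : R) :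
  0 < b -> b < c -> f @ \oo --> (0 : R) ->
  \forall n \near \oo, 1 <= (1 - b / n%:R * (1 + f n)) * (1 + c / n.+1%:R).
Proof.
move=> b0 bc f0; pose d := (b + c) / 2.
have bd : b < d by rewrite /d; lra.
have dc : d < c by rewrite /d; lra.
have db_gt0 : 0 < (d - b) / b by rewrite divr_gt0// subr_gt0.
(* Half of the slack pays for [f n], the other half for the terms of order
   [1 / n ^ 2]. *)
near=> n.
have n0 : (0 : R) < n%:R by rewrite ltr0n; near: n; exact: nbhs_infty_gt.
have bf : b * (1 + f n) <= d.
  have : `|f n| < (d - b) / b.
    by near: n; apply: (cvgr0_norm_lt _ f0).
  rewrite ltr_pdivlMr// => fn; have := ler_norm (f n).
  by move=> /(ler_wpM2l (ltW b0)); lra.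
(* This is the condition for [(n - d) (n + 1 + c) >= n (n + 1)]. *)
have nbig : d * (1 + c) <= (c - d) * n%:R.
  rewrite -ler_pdivrMl ?subr_gt0//.
  by near: n; exact: nbhs_infty_ger.
apply: (@le_trans _ _ ((1 - d / n%:R) * (1 + c / n.+1%:R))).
  have -> : (1 - d / n%:R) * (1 + c / n.+1%:R)
          = 1 + ((c - d) * n%:R - d * (1 + c)) / (n%:R * n.+1%:R).
    by rewrite -natr1; field; rewrite natr1 pnatr_eq0 (gt_eqF n0).
  by rewrite lerDl divr_ge0 ?mulr_ge0 ?subr_ge0.
apply: ler_wpM2r; first by rewrite addr_ge0// divr_ge0//; lra.
by rewrite lerB// mulrAC ler_wpM2r ?invr_ge0.
Unshelve. all: by end_near. Qed.

(** This makes [A(k)] tend to infinity with [k]; contraposed at [n = A(k) + 1],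
    it bounds [k] from above by [a_(A(k)+1)]. *)
Lemma le_counting_fun (R : realType) (A : set nat) (a : nat -> nat) (n k : nat) :
  A `<=` [set n | (0 < n)%N] -> increasing_enumeration A a ->
  (a n <= k)%N -> (n <= counting_fun A (k%:R : R))%N.
Proof.
move=> A_pos [a_incr a_im] ank; rewrite /counting_fun.
have -> : [set m | (m%:R : R) \in `[1, k%:R]] = [set m | (1 <= m <= k)%N].
  by apply/seteqP; split => m /=; rewrite in_itv/= ler1n ler_nat.
apply: leq_card_fset_set.
  by apply: (@sub_finite_set _ _ `I_k.+1) => // m [_ /= /andP[_]].
have a_mono i j : (0 < i)%N -> (i <= j)%N -> (a i <= a j)%N.
  move=> i0; rewrite leq_eqVlt => /predU1P[->//|ij].
  by rewrite ltnW// a_incr.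
have inj : {in `I_n &, injective (fun i => a i.+1)}.
  move=> i j _ _ /= aij; case: (ltngtP i j) => // ij.
  - by have := a_incr i.+1 j.+1 isT ij; rewrite aij ltnn.
  - by have := a_incr j.+1 i.+1 isT ij; rewrite aij ltnn.
have := inj_card_eq inj; rewrite card_eq_sym => /card_eqPle[le_n _].
apply: (card_le_trans le_n); apply: subset_card_le => _ [i /= ilt <-].
have Aai : A (a i.+1) by rewrite -a_im; exists i.+1.
split => //=; apply/andP; split; first exact: A_pos.
by rewrite (leq_trans _ ank)// a_mono.
Qed.

Lemma le_limn_einf (R : realType) (u : nat -> \bar R) (l : \bar R) :
  (\forall n \near \oo, l <= u n)%E -> (l <= limn_einf u)%E.
Proof.
move=> [N _ lu]; rewrite limn_einf_lim; apply: lime_ge.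
  exact: is_cvg_einfs.
exists N => // n /= Nn; apply: le_ereal_inf_tmp => _ [m /= nm <-].
by apply: lu; rewrite /= (leq_trans Nn).
Qed.

Lemma near_ln_ge (R : realType) (x : R) : \forall n \near \oo, x <= ln n%:R.
Proof.
near=> n; rewrite -[x]expRK ler_ln ?posrE ?expR_gt0//.
  by near: n; exact: nbhs_infty_ger.
by rewrite ltr0n; near: n; exact: nbhs_infty_gt.
Unshelve. all: by end_near. Qed.

(** A polynomial bound on the enumeration inverts to a power lower bound on the
    counting function; the multiplicative constant costs an arbitrarily small
    loss in the exponent, here the passage from [c] to [b]. *)
Lemma lower_exp_density_ge (R : realType) (A : set nat) (a : nat -> nat)
    (c C b : R) :
  A `<=` [set n | (0 < n)%N] -> increasing_enumeration A a ->
  0 <= c -> c < b ->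
  (\forall n \near \oo, ln (a n)%:R <= c * ln n%:R + C) ->
  ((1 / b)%:E <= lower_exp_density R A)%E.
Proof.
move=> A_pos a_enum c0 cb ln_a.
have good : \forall n \near \oo, [/\ (0 < n)%N,
    ln (a n.+1)%:R <= c * ln n.+1%:R + C & c + C <= (b - c) * ln (n%:R : R)].
  near=> n; split.
  - by near: n; exact: nbhs_infty_gt.
  - by near: n; case: ln_a => N _ HN; exists N => // n /= Nn; apply: HN; apply: leqW.
  - rewrite mulrC -ler_pdivrMr ?subr_gt0//.
    by near: n; exact: near_ln_ge.
case: good => N _ good; apply: le_limn_einf; near=> k.
have k2 : (1 < k)%N by near: k; exact: nbhs_infty_gt.
set n := counting_fun A (k%:R : R).
have Nn : (N <= n)%N.
  by apply: (le_counting_fun _ _ _ _ _ A_pos a_enum); near: k; exact: nbhs_infty_ge.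
have kan : (k < a n.+1)%N.
  rewrite ltnNge; apply/negP => /(le_counting_fun R _ _ _ _ A_pos a_enum).
  by rewrite -/n ltnn.
have [n0 ln_an nbig] := good n Nn.
have lnk : (0 : R) < ln k%:R by rewrite ln_gt0// ltr1n.
have ln_k : ln (k%:R : R) <= ln (a n.+1)%:R.
  have k0 := ltnW k2.
  by rewrite ler_ln ?posrE ?ltr0n// ?ler_nat ?(ltnW kan)// (ltn_trans k0 kan).
have lnS : ln (n.+1%:R : R) <= ln n%:R + 1.
  have -> : (n.+1%:R : R) = n%:R * (1 + n%:R^-1).
    by rewrite mulrDr mulr1 divff ?natr1// pnatr_eq0 -lt0n.
  have nV0 : (0 : R) < n%:R^-1 by rewrite invr_gt0 ltr0n.
  have nV1 : (n%:R : R)^-1 <= 1 by rewrite invf_le1 ?ltr0n// ler1n.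
  rewrite lnM ?posrE ?ltr0n ?addr_gt0// lerD2l (le_trans (le_ln1Dx _))//.
  by rewrite (lt_trans _ nV0)// ltrN10.
rewrite lee_fin -/n ler_pdivrMr; last by lra.
rewrite mulrAC ler_pdivlMr// mul1r.
by have := ler_wpM2l c0 lnS; rewrite mulrDr; lra.
Unshelve. all: by end_near. Qed.

Theorem theorem3p12 (R : realType) (A : set nat) (a : nat -> nat) (beta : R)
  (A_pos : A `<=` [set n | (0 < n)%N])
  (A_infinite : infinite_set A)
  (a_enum : increasing_enumeration A a)
  (beta_ge1 : 1 <= beta)
  (gap_le : exists f : nat -> R,
    (f @ \oo --> (0 : R)) /\
    (forall n : nat, (1 <= n)%N ->
       gap R a n / (a n.+1)%:R <= beta / n%:R * (1 + f n))) :
  ((1 / beta)%:E <= lower_exp_density R A)%E.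
Proof.
have [f [f0 gap_f]] := gap_le.
have a_gt0 n : (0 < n)%N -> (0 : R) < (a n)%:R.
  by move=> n0; rewrite ltr0n; apply: A_pos; case: a_enum => _ <-; exists n.
have density_ge b : beta < b -> ((1 / b)%:E <= lower_exp_density R A)%E.
  move=> beta_b; pose c := (beta + b) / 2.
  have [beta_c c_b] : beta < c /\ c < b by rewrite /c; split; lra.
  have [|||C ln_a] := @ln_le_of_ratio_le R (fun n => (a n)%:R) c.
  - by lra.
  - by exists 1%N.
  - near=> n.
    have n0 : (0 < n)%N by near: n; exact: nbhs_infty_gt.
    have an0 := a_gt0 n.+1 isT.
    have bound : 1 <= (1 - beta / n%:R * (1 + f n)) * (1 + c / n.+1%:R).
      by near: n; apply: near_ratio_bound => //; lra.
    have c1 : 0 <= 1 + c / n.+1%:R by rewrite addr_ge0// divr_ge0//; lra.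
    have an_ge : (1 - beta / n%:R * (1 + f n)) * (a n.+1)%:R <= (a n)%:R.
      by have := gap_f n n0; rewrite ler_pdivrMr// /gap; lra.
    rewrite (le_trans _ (ler_wpM2l c1 an_ge))// mulrA ler_peMl//.
    by rewrite mulrC.
  - by apply: (lower_exp_density_ge _ _ _ _ _ _ A_pos a_enum _ c_b ln_a); lra.
apply/lee_addgt0Pr => e e0.
rewrite -leeBlDr// (le_trans _ (density_ge (beta + e) _)) ?ltrDl// lee_fin.
(* The loss from [beta] to [beta + e] is [e / (beta (beta + e))], which is at
   most [e] because [beta >= 1]. *)
have -> : 1 / beta - e = 1 / (beta + e) - e * (1 - 1 / (beta * (beta + e))).
  by field; rewrite !gt_eqF//; lra.
rewrite gerBl mulr_ge0 ?(ltW e0)// subr_ge0 ler_pdivrMr; last first.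
  by apply: mulr_gt0; lra.
by rewrite !mul1r mulr_ege1//; lra.
Unshelve. all: by end_near. Qed.
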